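(* Let $(k,l)\in\mathcal{PC}$, $\mu\ge0$, $T>0$, and $n\in\mathbb{N}$, and let $k_n=k\ast h_n$, where $h_n\in L_{1,loc}([0,\infty))$ is the solution of $h_n(t)+n(h_n\ast l)(t)=n\,l(t)$, $t>0$. Suppose that $u,v,f\in L_1([0,T])$ are such that $$\partial_t(k_n\ast u)+\mu u\le f\quad\text{a.e. in }(0,T),$$ $$\partial_t(k_n\ast v)+\mu v\ge f\quad\text{a.e. in }(0,T).$$ Then $u\le v$ a.e. in $(0,T)$.
   Context: $(k\ast v)(t)=\int_0^tk(t-\tau)v(\tau)\,d\tau$. $(k,l)\in\mathcal{PC}$ means: $k\in L_{1,loc}([0,\infty))$ is nonnegative and nonincreasing, $l\in L_{1,loc}([0,\infty))$, and $k\ast l=1$ on $(0,\infty)$. (It is known that then $l\ge0$, $h_n\ge 0$, and that $k_n=n s_n$ is nonnegative, nonincreasing and belongs to $W^{1,1}([0,T])$ for all $T>0$, where $s_n$ solves $s_n+n\,l\ast s_n=1$ on $[0,\infty)$.) *)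

(* Defs.v *)
From HB Require Import structures.
From mathcomp Require Import all_boot all_order all_algebra.
From mathcomp Require Import all_classical all_reals all_analysis.
Export Order.TTheory GRing.Theory Num.Theory.
Export numFieldNormedType.Exports.

Set Implicit Arguments.
Unset Strict Implicit.
Unset Printing Implicit Defensive.

Local Open Scope classical_set_scope.
Local Open Scope ring_scope.

(* Elements of L_1([0,T]) and L_{1,loc}([0,oo)) are represented by functions
   R -> R, of which only the values on [0,T], resp. [0,oo), matter; identities
   between such elements are accordingly stated almost everywhere. *)

Section Kernels.
Context {R : realType}.
Implicit Types (k l h u v : R -> R) (n : nat) (T : R).

Definition L1 T u : Prop := lebesgue_measure.-integrable `[0, T] (EFin \o u).

Definition L1loc u : Prop := forall T, 0 < T -> L1 T u.

(* Only meaningful for t >= 0; the value is 0 for t < 0, as `[0, t] is empty. *)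
Definition convol k v : R -> R :=
  fun t => \int[lebesgue_measure]_(tau in `[0, t]) (k (t - tau) * v tau).

(* k is typically unbounded at 0, so nothing is required of the value k 0. *)
Record PC k l : Prop := {
  PC_L1loc_k : L1loc k ;
  PC_ge0 : forall t : R, 0 < t -> 0 <= k t ;
  PC_nonincreasing : forall s t : R, 0 < s -> s <= t -> k t <= k s ;
  PC_L1loc_l : L1loc l ;
  PC_convol : {ae lebesgue_measure, forall t : R, 0 < t -> convol k l t = 1} }.

(* h is the solution (unique up to null sets) of h + n (h * l) = n l. *)
Definition is_h l n h : Prop :=
  L1loc h /\
  {ae lebesgue_measure,
    forall t : R, 0 < t -> h t + n%:R * convol h l t = n%:R * l t}.

End Kernels.

(* Main.v *)
Require Import Defs.
From HB Require Import structures.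
From mathcomp Require Import all_boot all_order all_algebra.
From mathcomp Require Import all_classical all_reals all_analysis.
From mathcomp Require Import measurable_realfun ring lra.

(** Idea. All functions are cut off to ]0, T], so that the causal convolution
becomes the convolution [fconv] on the whole line. Write * for it, and 1 for the
cut-off constant.

Positivity of h: convolving h + n h*l = n l with k and using k*l = 1 gives
(k + n) * h = n, where kap := k + n is nonincreasing and bounded below by n > 0.
Let phi >= 0 be Lipschitz and vanish on ]-oo, 0], and put D := phi*h; then
kap*D = n (1*phi) is nondecreasing. If D had a negative minimum -m at b, then
E := D + m would be nonnegative, O(d) on [b - d, b], and satisfy
kap*E (b) - kap*E (b - d) >= m n d; since kap is nonincreasing this increment is
also at most O(d) times the integral of kap over ]0, d], which is o(d), a
contradiction. So D >= 0, and letting phi tend to indicators of intervals gives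
h >= 0.

Comparison: k*h = n (1 - 1*h) almost everywhere, so the derivative of (k*h)*u is
n (u - h*u). Hence y := max(0, u - v) satisfies y <= h*y. Then Z := 1*y satisfies
Z <= h*Z, and k*Z <= k*h*Z = n (1 * (Z - h*Z)) <= 0, so k*Z = 0. Convolving
with l gives 1*Z = 0, whence y = 0. *)

Set Implicit Arguments.
Unset Strict Implicit.
Unset Printing Implicit Defensive.

Local Open Scope classical_set_scope.
Local Open Scope ring_scope.
Import Order.TTheory GRing.Theory Num.Theory.

(** * Convolution on the whole line *)

Section FullLine.
Context {R : realType}.
Notation mu := (@lebesgue_measure R).

Lemma measurable_subl (t : R) : measurable_fun setT (fun x : R => t - x).
Proof. exact: measurable_funB. Qed.

Let subl_mixin (t : R) := @isMeasurableFun.Build _ _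
  (measurableTypeR R) (measurableTypeR R) _ (measurable_subl t).
Let subl (t : R) : {mfun measurableTypeR R >-> measurableTypeR R} :=
  HB.pack (fun x : R => t - x) (subl_mixin t).

(** By uniqueness of Lebesgue measure it suffices to test half-open intervals: the preimage of []a,
    b]] is [[t - b, t - a[], of the same length. *)
Lemma lebesgue_measure_reflect (t : R) (A : set (measurableTypeR R)) :
  measurable A -> mu ((fun x : R => t - x) @^-1` A) = mu A.
Proof.
move=> mA; apply/esym.
apply: (@lebesgue_measure_unique R (pushforward mu (subl t))) => //.
move=> X [[a b] _ <-]; rewrite /pushforward /=.
rewrite [X in _ = mu X](_ : _ = `[t - b, t - a[%classic); last first.
  by apply/seteqP; split => x /=; rewrite !in_itv /= => /andP[? ?];
    apply/andP; split; lra.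
rewrite !lebesgue_measure_itv /= !lte_fin ltrD2l ltrN2 -!EFinB.
by case: ifP => // _; congr EFin; ring.
Qed.

Local Open Scope ereal_scope.

Lemma ge0_integral_reflect (t : R) (f : R -> \bar R) :
  measurable_fun setT f -> (forall x, 0 <= f x) ->
  \int[mu]_x f (t - x)%R = \int[mu]_x f x.
Proof.
move=> mf f0.
transitivity (\int[pushforward mu (subl t)]_x f x).
  by rewrite ge0_integral_pushforward.
by apply: eq_measure_integral => A mA _; exact: lebesgue_measure_reflect.
Qed.

Lemma integral_reflect (t : R) (f : R -> \bar R) : measurable_fun setT f ->
  \int[mu]_x f (t - x)%R = \int[mu]_x f x.
Proof.
move=> mf; rewrite [RHS]integralE [LHS]integralE.
rewrite -(ge0_integral_reflect t (measurable_funepos mf))//.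
rewrite -(ge0_integral_reflect t (measurable_funeneg mf))//.
by congr (_ - _); apply: eq_integral => x _;
  rewrite (funepos_comp, funeneg_comp).
Qed.

(** A translation is the composite of two reflections. *)
Lemma integral_translate (s : R) (f : R -> \bar R) : measurable_fun setT f ->
  \int[mu]_x f (x - s)%R = \int[mu]_x f x.
Proof.
move=> mf; rewrite -(integral_reflect 0%R); last first.
  apply: measurableT_comp => //; exact: measurable_funB.
rewrite -[RHS](integral_reflect (- s)%R)//.
by apply: eq_integral => x _; congr f; ring.
Qed.

Local Close Scope ereal_scope.

Lemma Rintegral_reflect (t : R) (f : R -> R) : measurable_fun setT f ->
  \int[mu]_x f (t - x) = \int[mu]_x f x.
Proof.
move=> mf; congr fine; apply: (integral_reflect t (f := EFin \o f)).
exact/measurable_EFinP.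
Qed.

Lemma Rintegral_translate (s : R) (f : R -> R) : measurable_fun setT f ->
  \int[mu]_x f (x - s) = \int[mu]_x f x.
Proof.
move=> mf; congr fine; apply: (integral_translate s (f := EFin \o f)).
exact/measurable_EFinP.
Qed.

Implicit Types f g e phi : R -> R.

Definition integ (f : R -> R) := mu.-integrable setT (EFin \o f).

Lemma integ_measurable f : integ f -> measurable_fun setT f.
Proof. by move=> /measurable_int /measurable_EFinP. Qed.

Lemma integ_reflect (t : R) f : integ f -> integ (fun x => f (t - x)).
Proof.
move=> /integrableP[/measurable_EFinP mf fi]; apply/integrableP; split.
  by apply/measurable_EFinP; apply: measurableT_comp => //; exact: measurable_subl.
rewrite (ge0_integral_reflect t (f := fun x => `|(f x)%:E|%E))//.
by apply/measurableT_comp => //; exact/measurable_EFinP.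
Qed.

Lemma integ_translate (s : R) f : integ f -> integ (fun x => f (x - s)).
Proof.
move=> /(integ_reflect (- s)) /(integ_reflect 0).
by congr integ; apply/funext => x; congr f; ring.
Qed.

Definition fconv (f g : R -> R) : R -> R := fun t => \int[mu]_x (f (t - x) * g x).

Lemma measurable_fconv_integrand f g t : measurable_fun setT f ->
  measurable_fun setT g -> measurable_fun setT (fun x : R => f (t - x) * g x).
Proof.
move=> mf mg; apply: measurable_funM => //; apply: measurableT_comp => //.
exact: measurable_subl.
Qed.

Lemma fconvC f g : measurable_fun setT f -> measurable_fun setT g ->
  fconv f g = fconv g f.
Proof.
move=> mf mg; apply/funext => t; rewrite /fconv.
rewrite -(Rintegral_reflect t (measurable_fconv_integrand t mf mg)).
by apply: eq_Rintegral => x _; rewrite subKr mulrC.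
Qed.

Lemma integ_mulB f g (M : R) : measurable_fun setT g -> (forall x, `|g x| <= M) ->
  integ f -> integ (fun x => g x * f x).
Proof.
move=> mg gM fi.
have := @integrableMr _ _ _ mu setT measurableT g (EFin \o f) mg _ fi.
apply; exists M; split; first exact: num_real.
by move=> y My x _ /=; apply: (le_trans (gM x)); exact: ltW.
Qed.

End FullLine.

(** * Integrability, bounds and associativity of the convolution *)

Section Convolution.
Context {R : realType}.
Notation mu := (@lebesgue_measure R).
Implicit Types f g e phi : R -> R.

Let RR := (measurableTypeR R * measurableTypeR R)%type.

Let measurable_kernel f g : measurable_fun setT f -> measurable_fun setT g ->
  measurable_fun setT (fun z : RR => f (z.1 - z.2) * g z.2).
Proof.
move=> mf mg; apply: measurable_funM.
  apply: measurableT_comp => //; exact: measurable_funB.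
exact: measurableT_comp.
Qed.

(** Tonelli: integrating over [x] first and translating by [y] leaves the norm of [f] in [L^1] times
    [|g y|], which is integrable in [y]. *)
Let integrable_kernel f g : integ f -> integ g ->
  (mu \x mu)%E.-integrable setT (EFin \o (fun z : RR => f (z.1 - z.2) * g z.2)).
Proof.
move=> fi gi; have mf := integ_measurable fi; have mg := integ_measurable gi.
have mk : measurable_fun setT (EFin \o (fun z : RR => f (z.1 - z.2) * g z.2)).
  by apply/measurable_EFinP; exact: measurable_kernel.
apply/(integrable21ltyP _ _ mk) => /=.
have -> : (\int[mu]_y \int[mu]_x `|(f (x - y) * g y)%:E| =
    \int[mu]_y ((\int[mu]_x `|(f x)%:E|) * `|(g y)%:E|))%E.
  apply: eq_integral => y _.
  rewrite -(integral_translate y (f := fun x => `|(f x)%:E|%E)); last first.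
    by apply: measurableT_comp => //; exact/measurable_EFinP.
  rewrite -ge0_integralZr//.
    by apply: eq_integral => x _; rewrite -abseM.
  apply: measurableT_comp => //; apply/measurable_EFinP.
  by apply: measurableT_comp => //; exact: measurable_funB.
have [r rE] : exists r : R, (\int[mu]_x `|(f x)%:E|)%E = r%:E.
  have /integrableP[_ /= fioo] := fi.
  exists (fine (\int[mu]_x `|(f x)%:E|)%E); rewrite fineK// ge0_fin_numE//.
  by apply: integral_ge0.
rewrite rE; have /integrable_abse /(integrableZl measurableT r) := gi.
by move=> /integrable_lty; exact.
Qed.

Lemma ae_integ_section f g : integ f -> integ g ->
  {ae mu, forall x, integ (fun y => f (x - y) * g y)}.
Proof.
move=> fi gi; have := ae_integrable1 (integrable_kernel fi gi).
by apply: filterS => x.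
Qed.

Lemma integ_fconv f g : integ f -> integ g -> integ (fconv f g).
Proof.
move=> fi gi; have Fi := integrable_fubini_F (integrable_kernel fi gi).
apply: le_integrable Fi => //.
  apply/measurable_EFinP; apply: measurableT_comp => //.
  exact: (measurable_int mu (integrable_fubini_F (integrable_kernel fi gi))).
move=> x _ /=; rewrite /fconv /Rintegral /fubini_F /=.
(* [fine] sends infinite values to 0, so [fconv f g] is dominated by the Fubini integral at the
   exceptional points too. *)
by case: (integral _ _ _) => [r| |]  /=; rewrite ?normr0 ?leey ?lexx.
Qed.

Lemma fconv_bounded phi f (M : R) : measurable_fun setT phi ->
  (forall x, `|phi x| <= M) -> integ f ->
  forall x, `|fconv phi f x| <= M * \int[mu]_y `|f y|.
Proof.
move=> mphi phiM fi x; have fni := integrable_norm fi.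
have iphif : integ (fun y => phi (x - y) * f y).
  apply: (integ_mulB (M := M)) => //.
  by apply: measurableT_comp => //; exact: measurable_funB.
apply: (le_trans (le_normr_Rintegral measurableT iphif)).
rewrite -RintegralZl//; apply: le_Rintegral => //.
- exact: (integrable_norm iphif).
- have := integrableZl measurableT M fni.
  by apply: eq_integrable => // z _ /=; rewrite -EFinM.
- by move=> y _; rewrite normrM ler_wpM2r.
Qed.

(* The bound on phi makes the associativity hold at every point and not just
   almost everywhere. *)
Lemma fconvA phi f g (M : R) : integ phi -> (forall x, `|phi x| <= M) ->
  integ f -> integ g -> fconv phi (fconv f g) = fconv (fconv phi f) g.
Proof.
move=> phii phiM fi gi; apply/funext => t.
have mphi := integ_measurable phii.
have mf := integ_measurable fi.
have mc := integ_measurable (integ_fconv fi gi).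
have mpt : measurable_fun setT (fun s : R => phi (t - s)).
  by apply: measurableT_comp => //; exact: measurable_funB.
have Hi : (mu \x mu)%E.-integrable setT
    (EFin \o (fun z : RR => phi (t - z.1) * (f (z.1 - z.2) * g z.2))).
  have := @integrableMr _ _ _ (mu \x mu)%E setT measurableT
    (fun z : RR => phi (t - z.1)) _ _ _ (integrable_kernel fi gi).
  apply; first by apply: (measurableT_comp mpt).
  exists M; split; first exact: num_real.
  by move=> y My x _ /=; apply: (le_trans (phiM _)); exact: ltW.
rewrite /fconv /Rintegral; congr fine.
(* The section in [y] is integrable only for almost every [s], so [phi (t - s)] enters the inner
   integral almost everywhere only; this suffices under the integral over [s]. *)
transitivity (\int[mu]_s \int[mu]_y
    (phi (t - s) * (f (s - y) * g y))%:E)%E.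
  apply: ae_eq_integral => //.
  - by apply/measurable_EFinP; exact: measurable_funM.
  - exact: (measurable_fubini_F Hi).
  have := ae_integ_section fi gi.
  apply: filterS; first exact: (ae_filter_ringOfSetsType mu).
  move=> s si _ /=.
  rewrite EFinM fineK; last exact: integrable_fin_num.
  by rewrite -integralZl//; apply: eq_integral => y _.
rewrite (Fubini Hi); apply: eq_integral => y _ /=.
have fyi := integ_translate y fi.
have ifi : integ (fun s => phi (t - s) * f (s - y)) by exact: (integ_mulB mpt).
transitivity (\int[mu]_s ((g y)%:E * (phi (t - s) * f (s - y))%:E))%E.
  by apply: eq_integral => s _; rewrite -EFinM; congr EFin; ring.
rewrite integralZl// EFinM fineK; last first.
  apply: integrable_fin_num => //; apply: (integ_mulB (M := M)) => //.
  by apply: measurableT_comp => //; exact: measurable_funB.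
rewrite muleC; congr (_ * _)%E.
rewrite -[RHS](integral_translate y); last first.
  apply/measurable_EFinP; apply: measurable_funM => //.
  by apply: measurableT_comp => //; exact: measurable_funB.
by apply: eq_integral => s _; congr (EFin (phi _ * _)); ring.
Qed.

End Convolution.

(** * Causal functions *)

Section Causal.
Context {R : realType}.
Notation mu := (@lebesgue_measure R).
Implicit Types (f g e phi : R -> R) (T t x : R).

Lemma ae_imply (P Q : R -> Prop) : (forall x, P x -> Q x) ->
  {ae mu, forall x, P x} -> {ae mu, forall x, Q x}.
Proof.
by move=> PQ; apply: filterS; [exact: (ae_filter_ringOfSetsType mu)|exact: PQ].
Qed.

Lemma ae_imply2 (P Q S : R -> Prop) : (forall x, P x -> Q x -> S x) ->
  {ae mu, forall x, P x} -> {ae mu, forall x, Q x} -> {ae mu, forall x, S x}.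
Proof.
by move=> PQS; apply: filterS2; [exact: (ae_filter_ringOfSetsType mu)|exact: PQS].
Qed.

(* The left endpoint is excluded because nothing is known about k 0. *)
Definition cutoff T f : R -> R := f \_ `]0, T].

Definition causal f := forall x, x <= 0 -> f x = 0.

Lemma cutoffE T f x : cutoff T f x = if (0 < x) && (x <= T) then f x else 0.
Proof. by rewrite /cutoff patchE /= mem_setE /= in_itv. Qed.

Lemma cutoff_in T f x : 0 < x -> x <= T -> cutoff T f x = f x.
Proof. by rewrite cutoffE => -> ->. Qed.

Lemma causal_cutoff T f : causal (cutoff T f).
Proof. by move=> x x0; rewrite cutoffE ltNge x0. Qed.

Lemma integ_cutoff T f : L1 T f -> integ (cutoff T f).
Proof.
rewrite /L1 => fi; rewrite /integ /cutoff -restrict_EFin.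
apply: (integrable_mkcond _ _).1 => //; apply: integrableS fi => //.
exact: subset_itv_oc_cc.
Qed.

Lemma causal_fconv f g : causal f -> causal g -> causal (fconv f g).
Proof.
move=> cf cg t t0; rewrite /fconv (_ : (fun _ => _) = cst 0); last first.
  apply/funext => x /=; have [/cg ->|x0] := leP x 0; first by rewrite mulr0.
  by rewrite cf ?mul0r //; lra.
by rewrite Rintegral_cst// mul0r.
Qed.

Lemma eq_Rintegral_ae f g : measurable_fun setT f -> measurable_fun setT g ->
  {ae mu, forall x, f x = g x} -> \int[mu]_x f x = \int[mu]_x g x.
Proof.
move=> mf mg fg; congr fine; apply: ae_eq_integral => //.
- exact/measurable_EFinP.
- exact/measurable_EFinP.
- have : {ae mu, forall x, [set: R] x -> (EFin \o f) x = (EFin \o g) x}.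
    by apply: ae_imply fg => x /= -> _.
  exact.
Qed.

(** By causality [f (t - x)] vanishes for [x >= T >= t], so only values of [g1] and [g2] below [T]
    enter, and an almost everywhere identity there becomes an identity at every [t <= T]. *)
Lemma eq_fconv_ae T f g1 g2 : causal f -> measurable_fun setT f ->
  measurable_fun setT g1 -> measurable_fun setT g2 ->
  {ae mu, forall x, x < T -> g1 x = g2 x} ->
  forall t, t <= T -> fconv f g1 t = fconv f g2 t.
Proof.
move=> cf mf mg1 mg2 g12 t tT; apply: eq_Rintegral_ae.
- exact: measurable_fconv_integrand.
- exact: measurable_fconv_integrand.
apply: ae_imply g12 => x g12; have [/g12 -> //|xT] := ltP x T.
by rewrite cf ?mul0r //; lra.
Qed.

Lemma fconvDr f g1 g2 t : integ (fun x => f (t - x) * g1 x) ->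
  integ (fun x => f (t - x) * g2 x) ->
  fconv f (fun x => g1 x + g2 x) t = fconv f g1 t + fconv f g2 t.
Proof.
move=> i1 i2; rewrite /fconv -RintegralD//.
by apply: eq_Rintegral => x _; rewrite mulrDr.
Qed.

Lemma fconvZr f g (c : R) t : integ (fun x => f (t - x) * g x) ->
  fconv f (fun x => c * g x) t = c * fconv f g t.
Proof.
move=> i1; rewrite /fconv -RintegralZl//.
by apply: eq_Rintegral => x _; rewrite mulrCA.
Qed.

(** For [0 < x < t] neither cut-off is active at the arguments involved, and outside []0, t[] one of
    the causal factors vanishes. The endpoints are null sets, so the unspecified values at 0 are
    harmless. *)
Lemma convol_fconv T f g t : L1 T f -> L1 T g -> t <= T ->
  convol f g t = fconv (cutoff T f) (cutoff T g) t.
Proof.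
move=> /integ_cutoff fi /integ_cutoff gi tT.
have [t0|t0] := leP t 0.
  rewrite (causal_fconv (@causal_cutoff T f) (@causal_cutoff T g))//.
  rewrite /convol; move: t0; rewrite le_eqVlt => /predU1P[->|t0].
    by rewrite set_itv1 Rintegral_set1.
  by rewrite set_itv_ge ?Rintegral_set0// bnd_simp -ltNge.
have E x : (0 < x) && (x < t) -> f (t - x) * g x = cutoff T f (t - x) * cutoff T g x.
  by move=> /andP[? ?]; rewrite !cutoff_in//; lra.
have mE : measurable_fun `]0, t[ (EFin \o (fun x => f (t - x) * g x)).
  apply: (eq_measurable_fun (EFin \o (fun x => cutoff T f (t - x) * cutoff T g x))).
    by move=> x; rewrite inE /= in_itv /= => /E ->.
  apply/measurable_funTS/measurable_EFinP.
  by apply: measurable_fconv_integrand; exact: integ_measurable.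
have mE' : measurable_fun `[0, t[ (EFin \o (fun x => f (t - x) * g x)).
  by apply/emeasurable_fun_itv_obnd_cbndP.
rewrite /convol /fconv /Rintegral; congr fine.
rewrite -integral_itv_bndo_bndc// -integral_itv_obnd_cbnd//.
rewrite [LHS]integral_mkcond; apply: eq_integral => x _.
rewrite patchE mem_setE /= in_itv /=; case: ifPn => [/E ->//|].
rewrite negb_and -!leNgt => /orP[x0|xt].
  by rewrite (@causal_cutoff T g)// mulr0.
by rewrite (@causal_cutoff T f) ?mul0r//; lra.
Qed.

(** Starting at [-oo] avoids a case distinction at 0; for causal [f] and [t >= 0] this is the
    integral from 0. *)
Definition primitive f : R -> R := fun t => \int[mu]_(x in `]-oo, t]) f x.

Lemma integ_itvNy f t : integ f -> mu.-integrable `]-oo, t] (EFin \o f).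
Proof. by apply: integrableS. Qed.

(** Only [x] in []0, t[] contributes, and there [t - x <= T] is automatic, so the cut-off constant
    acts as the Heaviside function. *)
Lemma fconv_one T f t : integ f -> causal f -> t <= T ->
  fconv (cutoff T (cst 1)) f t = primitive f t.
Proof.
move=> fi cf tT; rewrite /primitive /Rintegral -integral_itv_bndo_bndc; last first.
  by apply: measurable_funTS; apply/measurable_EFinP; exact: integ_measurable.
rewrite [in RHS]integral_mkcond; congr fine; apply: eq_integral => x _.
rewrite patchE mem_setE /= in_itv /= cutoffE; have [x0|x0] := leP x 0.
  by rewrite cf// mulr0 if_same.
have -> : (0 < t - x) && (t - x <= T) = (x < t).
  by rewrite subr_gt0; case: (ltP x t) => //= _; lra.
by case: ifP => _; rewrite /= ?mul1r ?mul0r.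
Qed.

Lemma primitive_ae_derive f : integ f ->
  {ae mu, forall t, derivable (primitive f) t 1 /\ derive1 (primitive f) t = f t}.
Proof.
move=> fi; apply: FTC1Ny; first by move=> y; exact: integ_itvNy.
by rewrite -(patch_setT (fun=> point) f); apply: integrable_locally.
Qed.

Lemma nondecreasing_derive1_ge0 (F : R -> R) T x :
  (forall s t, s <= t -> t < T -> F s <= F t) ->
  derivable F x 1 -> x < T -> 0 <= derive1 F x.
Proof.
move=> ndF dF xT; rewrite derive1E; apply: limr_ge; first exact: dF.
have Tx : 0 < T - x by lra.
near=> h.
have hT : `|h| < T - x by near: h; exact: dnbhs0_lt.
have h0 : h != 0 by near: h; exact: nbhs_dnbhs_neq.
rewrite /= [h *: 1]mulr1; move: h0 hT; rewrite neq_lt => /orP[h0|h0] hT.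
  rewrite -[_ *: _]/(_ * _) nmulr_rge0 ?invr_lt0// subr_le0.
  by apply: ndF => //; lra.
rewrite -[_ *: _]/(_ * _) pmulr_rge0 ?invr_gt0// subr_ge0.
by move: hT; rewrite gtr0_norm// => hT; apply: ndF; lra.
Unshelve. all: by end_near. Qed.

Lemma nondecreasing_primitive_ge0 T f : integ f ->
  (forall s t, s <= t -> t < T -> primitive f s <= primitive f t) ->
  {ae mu, forall t, t < T -> 0 <= f t}.
Proof.
move=> fi nd; apply: ae_imply (primitive_ae_derive fi) => t [df <-] tT.
exact: nondecreasing_derive1_ge0 nd df tT.
Qed.

Lemma primitive_eq0 T f : integ f -> (forall t, t < T -> primitive f t = 0) ->
  {ae mu, forall t, t < T -> f t = 0}.
Proof.
move=> fi f0; apply: ae_imply (primitive_ae_derive fi) => t [_ <-] tT.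
rewrite derive1E (near_eq_derive (g := cst 0)) ?derive_cst//.
by near=> s; apply: f0; near: s; exact: lt_nbhsl.
Unshelve. all: by end_near. Qed.

End Causal.

(** * The resolvent identity against bounded test functions *)

Section Resolvent.
Context {R : realType}.
Notation mu := (@lebesgue_measure R).
Implicit Types (f g phi : R -> R) (t x : R).

Lemma integ_cutoff_cst (T c : R) : integ (cutoff T (cst c)).
Proof.
have oo : (mu `[0%R, T] < +oo)%E.
  by rewrite lebesgue_measure_itv /=; case: ifP => _; rewrite ?ltry.
apply: integ_cutoff; apply: measurable_bounded_integrable => //.
- by exists `|c|; split; [exact: num_real|move=> M cM x _; exact: ltW].
Qed.

Lemma cutoff_cst_le1 (T : R) x : `|cutoff T (cst 1) x| <= 1.
Proof. by rewrite cutoffE; case: ifP => _; rewrite ?normr1 ?normr0. Qed.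

Lemma integD f g : integ f -> integ g -> integ (fun x => f x + g x).
Proof.
move=> fi gi; have := integrableD measurableT fi gi.
by apply: eq_integrable => // x _ /=.
Qed.

Lemma integZ (c : R) f : integ f -> integ (fun x => c * f x).
Proof.
move=> fi; have := integrableZl measurableT c fi.
by apply: eq_integrable => // x _ /=; rewrite -EFinM.
Qed.

Lemma integ_fconv_integrand f g (M t : R) : measurable_fun setT f ->
  (forall x, `|f x| <= M) -> integ g -> integ (fun x => f (t - x) * g x).
Proof.
move=> mf fM gi; apply: (integ_mulB (M := M)) => //.
by apply: measurableT_comp => //; exact: measurable_subl.
Qed.

Lemma integ_max f g : integ f -> integ g -> integ (fun x => Num.max (f x) (g x)).
Proof.
move=> fi gi; have fgi := integD (integrable_norm fi) (integrable_norm gi).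
apply: le_integrable fgi => //.
  by apply/measurable_EFinP/measurable_maxr; exact: integ_measurable.
move=> x _ /=; rewrite lee_fin [leRHS]ger0_norm ?addr_ge0//.
by case: (leP (f x) (g x)) => _; rewrite ?lerDl ?lerDr.
Qed.

(** The maximum of [g1] and [g2] dominates [g1] everywhere and equals [g2] almost everywhere below
    [T], so monotonicity of the integral combines with [eq_fconv_ae]. *)
Lemma le_fconv_ae f g1 g2 (T M : R) : measurable_fun setT f -> causal f ->
  (forall x, 0 <= f x) -> (forall x, `|f x| <= M) -> integ g1 -> integ g2 ->
  {ae mu, forall x, x < T -> g1 x <= g2 x} ->
  forall t, t <= T -> fconv f g1 t <= fconv f g2 t.
Proof.
move=> mf fc f0 fM g1i g2i g12 t tT; have mi := integ_max g1i g2i.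
apply: (@le_trans _ _ (fconv f (fun x => Num.max (g1 x) (g2 x)) t)).
  apply: le_Rintegral => //; [exact: integ_fconv_integrand fM g1i|
    exact: integ_fconv_integrand fM mi|].
  by move=> x _; rewrite ler_wpM2l// le_max lexx.
rewrite le_eqVlt (@eq_fconv_ae _ T f _ g2) ?eqxx//; try exact: integ_measurable.
by apply: ae_imply g12 => x g12 /g12 /max_r.
Qed.

Context (T n : R) (K L H : R -> R).
Hypotheses (Ki : integ K) (Li : integ L) (Hi : integ H).
Hypotheses (Kc : causal K) (Hc : causal H).
Notation one := (cutoff T (cst 1)).
Hypothesis KL : {ae mu, forall x, x < T -> fconv K L x = one x}.
Hypothesis HL : {ae mu, forall x, x < T -> H x + n * fconv H L x = n * L x}.

(** Convolve [HL] with [G = phi * K] and put [D = phi * H]. Commutativity, associativity and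
    [K * L = one] turn the three terms into [K * D], [n (one * D)] and [n (one * phi)]. Boundedness
    of [phi] passes to [D] and [G], so each step holds at every [t <= T]. *)
Lemma resolvent_identity phi (M : R) : integ phi -> causal phi ->
  (forall x, `|phi x| <= M) -> forall t, t <= T ->
  fconv K (fconv phi H) t + n * fconv one (fconv phi H) t =
  n * fconv one phi t.
Proof.
move=> phii phic phiM t tT.
have onei := integ_cutoff_cst T 1.
have mphi := integ_measurable phii; have mone := integ_measurable onei.
have mK := integ_measurable Ki; have mL := integ_measurable Li.
have mH := integ_measurable Hi.
pose D := fconv phi H; pose G := fconv phi K.
have Di : integ D by exact: integ_fconv.
have Gi : integ G by exact: integ_fconv.
have mD := integ_measurable Di; have mG := integ_measurable Gi.
have DM := fconv_bounded mphi phiM Hi.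
have GM := fconv_bounded mphi phiM Ki.
have HLi := integ_fconv Hi Li; have KLi := integ_fconv Ki Li.
have GH : fconv G H = fconv D K.
  by rewrite -(fconvA phii phiM Ki Hi) (fconvC mK mH) (fconvA phii phiM Hi Ki).
have GHL : fconv G (fconv H L) t = fconv one D t.
  rewrite (fconvA Gi GM Hi Li) GH -(fconvA Di DM Ki Li) (fconvC mone mD).
  apply: eq_fconv_ae tT => //; first exact: causal_fconv.
  exact: integ_measurable.
have GL : fconv G L t = fconv one phi t.
  rewrite -(fconvA phii phiM Ki Li) (fconvC mone mphi).
  by apply: eq_fconv_ae tT => //; exact: integ_measurable.
rewrite (fconvC mK mD) -/D -GH -GHL -GL.
rewrite -!fconvZr; do 1?exact: integ_fconv_integrand GM _.
rewrite -fconvDr; do 1?[exact: integ_fconv_integrand GM _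
  |by apply: integ_fconv_integrand GM _ => //; exact: integZ].
apply: eq_fconv_ae tT => //; first exact: causal_fconv.
- by apply: integ_measurable; apply: integD => //; exact: integZ.
- by apply: integ_measurable; exact: integZ.
Qed.

End Resolvent.

(** * Primitives, and Lipschitz and shift estimates for convolutions *)

Section Primitive.
Context {R : realType}.
Notation mu := (@lebesgue_measure R).
Implicit Types (f g phi : R -> R) (s t x : R).

Lemma primitiveB f s t : integ f -> s <= t ->
  primitive f t - primitive f s = \int[mu]_(x in `]s, t]) f x.
Proof.
by move=> fi st; rewrite /primitive Rintegral_itvB//; exact: integ_itvNy.
Qed.

Lemma primitive_causal f t : causal f -> t <= 0 -> primitive f t = 0.
Proof.
move=> cf t0; rewrite /primitive -(mul0r (fine (mu `]-oo, t]))).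
rewrite -Rintegral_cst//; apply: eq_Rintegral => x.
by rewrite inE /= in_itv /= => xt; rewrite cf//; exact: le_trans xt t0.
Qed.

Lemma integrable_subset f (A : set R) : measurable A -> integ f ->
  mu.-integrable A (EFin \o f).
Proof. by move=> mA; exact: integrableS. Qed.

(** Absolute continuity of the integral, applied to []0, x]]. *)
Lemma primitive_small f (e : R) : integ f -> causal f -> 0 < e ->
  exists2 d, 0 < d & forall x, 0 < x -> x < d -> primitive f x < e.
Proof.
move=> fi cf e0; have [d [d0 dP]] := integral_normr_continuous fi e0.
exists d => // x x0 xd.
rewrite -[primitive f x]subr0 -(primitive_causal cf (lexx 0)).
rewrite primitiveB//; last exact: ltW.
have fxi : mu.-integrable `]0, x] (EFin \o f) by exact: integrable_subset.
have xdE : (mu `]0%R, x] < d%:E)%E.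
  by rewrite lebesgue_measure_itv /= lte_fin x0 sube0 lte_fin.
apply: le_lt_trans (dP `]0%R, x]%classic _ xdE) => //.
by apply: (le_trans (ler_norm _)); exact: le_normr_Rintegral.
Qed.

Lemma Rintegral_itv_oc_cst s t (c : R) : s <= t ->
  \int[mu]_(x in `]s, t]) c = c * (t - s).
Proof.
move=> st; have E : mu `]s, t] = (t - s)%:E.
  rewrite lebesgue_measure_itv /= lte_fin.
  by move: st; rewrite le_eqVlt => /predU1P[->|->//]; rewrite ltxx subrr.
by rewrite Rintegral_cst// -[X in _ * X]/(fine (mu `]s, t])) E.
Qed.

Lemma integrable_itv_oc_cst s t (c : R) :
  mu.-integrable `]s, t] (EFin \o cst c).
Proof.
have oo : (mu `]s, t] < +oo)%E.
  by rewrite lebesgue_measure_itv /=; case: ifP => _; rewrite ?ltry.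
apply: measurable_bounded_integrable => //.
by exists `|c|; split; [exact: num_real|move=> M cM x _; exact: ltW].
Qed.

Lemma fconv_lipschitz phi f (c M : R) : measurable_fun setT phi ->
  (forall x, `|phi x| <= M) -> (forall x y, `|phi x - phi y| <= c * `|x - y|) ->
  integ f -> forall s t,
  `|fconv phi f s - fconv phi f t| <= c * (\int[mu]_x `|f x|) * `|s - t|.
Proof.
move=> mphi phiM phic fi s t.
have i1 := integ_fconv_integrand s mphi phiM fi.
have i2 := integ_fconv_integrand t mphi phiM fi.
rewrite /fconv -RintegralB//.
have i3 : integ (fun x => phi (s - x) * f x - phi (t - x) * f x).
  have := integrableB measurableT i1 i2.
  by apply: eq_integrable => // x _ /=.
have i4 : integ (fun x => `|f x|) := integrable_norm fi.
apply: (le_trans (le_normr_Rintegral measurableT i3)).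
rewrite mulrAC -RintegralZl//; apply: le_Rintegral => //.
- exact: (integrable_norm i3).
- exact: integZ.
move=> x _; rewrite -mulrBl normrM ler_wpM2r//.
by apply: (le_trans (phic _ _)); rewrite opprB addrA subrK.
Qed.

(* The increments of fconv E kap are controlled by a short initial piece of kap,
   because kap is nonincreasing. *)
Lemma fconv_shift_le E kap (T M b d c : R) : integ E -> causal E ->
  (forall x, `|E x| <= M) -> integ kap -> causal kap ->
  (forall x, x <= T -> 0 <= kap x) ->
  (forall x y, 0 < x -> x <= y -> y <= T -> kap y <= kap x) ->
  0 < d -> d < b -> b <= T ->
  (forall x, 0 < x -> x <= b -> 0 <= E x) ->
  (forall x, 0 < x -> x <= d -> E (b - x) <= c) ->
  fconv E kap b <= fconv E kap (b - d) + c * primitive kap d.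
Proof.
move=> Ei Ec EM kapi kapc kap0 kap_nincr d0 db bT E0 Ed.
have mE := integ_measurable Ei; have mkap := integ_measurable kapi.
pose kd := kap \_ `]-oo, d].
have kdi : integ kd.
  rewrite /integ /kd -restrict_EFin; apply: (integrable_mkcond _ _).1 => //.
  exact: integ_itvNy.
(* Translating by [d] moves the shift from [E] onto [kap], so that the two convolutions compare
   integrand by integrand. *)
have -> : fconv E kap (b - d) = \int[mu]_x (E (b - x) * kap (x - d)).
  have := Rintegral_translate d (measurable_fconv_integrand (b - d) mE mkap).
  by rewrite /fconv => <-; apply: eq_Rintegral => x _; congr (E _ * _); ring.
have i1 := integ_fconv_integrand b mE EM kapi.
have i2 := integ_fconv_integrand b mE EM (integ_translate d kapi).
rewrite /primitive [X in c * X]Rintegral_mkcond -/kd -RintegralZl//.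
rewrite -RintegralD//; last exact: integZ.
apply: le_Rintegral => //; first by apply: integD => //; exact: integZ.
move=> x _; rewrite /kd patchE mem_setE /= in_itv /=.
(* For [x <= 0] all terms vanish. On []0, d]] the shifted kernel vanishes and [E (b - x) <= c]; on
   []d, b[] monotonicity of [kap] decides; from [b] on, [E (b - x)] is 0. *)
have [x0|x0] := leP x 0.
  rewrite (kapc _ x0) mulr0 kapc ?mulr0 ?add0r.
    by case: ifP; rewrite mulr0.
  by rewrite subr_le0 (le_trans x0)// ltW.
have [xd|dx] := leP x d.
  rewrite (kapc (x - d)) ?subr_le0// mulr0 add0r.
  by apply: ler_wpM2r; [apply: kap0; lra|exact: Ed].
rewrite mulr0 addr0; have [bx|xb] := leP b x.
  by rewrite Ec ?mul0r// subr_le0.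
by apply: ler_wpM2l; [apply: E0; lra|apply: kap_nincr; lra].
Qed.

End Primitive.

(** * Positivity of the resolvent *)

Section Positivity.
Context {R : realType}.
Notation mu := (@lebesgue_measure R).
Implicit Types (f g phi : R -> R) (t x : R).

Context (T n : R) (K L H : R -> R).
Hypotheses (Ki : integ K) (Li : integ L) (Hi : integ H).
Hypotheses (Kc : causal K) (Hc : causal H).
Notation one := (cutoff T (cst 1)).
Hypothesis KL : {ae mu, forall x, x < T -> fconv K L x = one x}.
Hypothesis HL : {ae mu, forall x, x < T -> H x + n * fconv H L x = n * L x}.
Hypotheses (n0 : 0 < n).
Hypothesis K0 : forall x, 0 <= K x.
Hypothesis Knincr : forall x y, 0 < x -> x <= y -> y <= T -> K y <= K x.

Let kap x := K x + n * one x.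

Let kapi : integ kap.
Proof. by apply: integD => //; apply: integZ; exact: integ_cutoff_cst. Qed.

Let kapc : causal kap.
Proof. by move=> x x0; rewrite /kap Kc// causal_cutoff// mulr0 addr0. Qed.

Let kap_ge x : 0 < x -> x <= T -> n <= kap x.
Proof. by move=> x0 xT; rewrite /kap cutoff_in// mulr1 lerDr. Qed.

Let kap_nincr x y : 0 < x -> x <= y -> y <= T -> kap y <= kap x.
Proof.
move=> x0 xy yT; rewrite /kap !cutoff_in//; try lra.
by rewrite lerD2r; exact: Knincr.
Qed.

Let kap_identity phi (M : R) : integ phi -> causal phi -> (forall x, `|phi x| <= M) ->
  forall t, t <= T -> fconv (fconv phi H) kap t = n * primitive phi t.
Proof.
move=> phii phic phiM t tT.
have onei := integ_cutoff_cst T 1.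
have mphi := integ_measurable phii; have mone := integ_measurable onei.
have Di := integ_fconv phii Hi; have mD := integ_measurable Di.
have DM := fconv_bounded mphi phiM Hi.
rewrite -(fconv_one phii phic tT).
rewrite -(resolvent_identity Ki Li Hi Kc Hc KL HL phii phic phiM tT).
rewrite (fconvC (integ_measurable Ki) mD) (fconvC mone mD).
rewrite -fconvZr -?fconvDr//.
- exact: integ_fconv_integrand DM Ki.
- by apply: integ_fconv_integrand DM _ => //; exact: integZ.
- exact: integ_fconv_integrand DM onei.
Qed.

Lemma fconv_resolvent_ge0 phi (c M : R) : integ phi -> causal phi ->
  (forall x, `|phi x| <= M) -> (forall x y, `|phi x - phi y| <= c * `|x - y|) ->
  (forall x, 0 <= phi x) -> forall t, t <= T -> 0 <= fconv phi H t.
Proof.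
move=> phii phic phiM philip phi0 t tT.
have mphi := integ_measurable phii.
have [t0|t0] := leP t 0; first by rewrite (causal_fconv phic Hc).
pose D := fconv phi H; pose C := c * \int[mu]_x `|H x|.
have Dc : causal D by exact: causal_fconv.
have Di : integ D by exact: integ_fconv.
have Dlip x y : `|D x - D y| <= C * `|x - y|.
  exact: fconv_lipschitz mphi phiM philip Hi x y.
have C0 : 0 <= C.
  by have := le_trans (normr_ge0 _) (Dlip 1 0); rewrite subr0 normr1 mulr1.
(* [C] may be 0, so the quotient below uses [C + 1]. *)
have C1 : 0 < C + 1 by rewrite ltr_wpDl.
have Dcont : {within `[0, t], continuous D}.
  apply: continuous_subspaceT => x; apply/cvgrPdist_lt => /= e e0.
  near=> y; apply: (le_lt_trans (Dlip _ _)).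
  rewrite (@le_lt_trans _ _ ((C + 1) * `|x - y|))//.
    by rewrite ler_wpM2r//; lra.
  rewrite -ltr_pdivlMl// mulrC; near: y; apply: cvgr_dist_lt => //.
  by rewrite divr_gt0.
have [b + Dmin] := EVT_min (ltW t0) Dcont.
rewrite in_itv /= => /andP[b0 bt].
rewrite leNgt; apply/negP => Dt0.
have Db0 : D b < 0.
  by apply: le_lt_trans Dt0; apply: Dmin; rewrite in_itv /= lexx ltW.
have {}b0 : 0 < b.
  by rewrite lt_neqAle b0 andbT; apply: contraTneq Db0 => <-; rewrite Dc// ltxx.
pose m := - D b; have m0 : 0 < m by rewrite /m; lra.
(* The threshold makes [(C + 1) * primitive kap de < m * n], which contradicts [lower] and [upper]
   once these are combined and divided by [de]. *)
have [d d0 dP] : exists2 d, 0 < d & forall x, 0 < x -> x < d ->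
    primitive kap x < m * n / (C + 1).
  by apply: primitive_small => //; rewrite divr_gt0 ?mulr_gt0//; lra.
pose de := Num.min (d / 2) (b / 2).
have [de0 ded deb] : [/\ 0 < de, de < d & de < b].
  by rewrite /de; split; case: (leP (d / 2) (b / 2)); lra.
(* Adding the cut-off of the constant [m] keeps [E] causal; on []0, T]] it equals [D - D b]. *)
pose E x := D x + m * one x.
have onei := integ_cutoff_cst T 1.
have Ei : integ E by apply: integD => //; exact: integZ.
have mE := integ_measurable Ei.
have mD := integ_measurable Di; have mone := integ_measurable onei.
have DM := fconv_bounded mphi phiM Hi.
have EM x : `|E x| <= M * (\int[mu]_y `|H y|) + m.
  rewrite (le_trans (ler_normD _ _))// lerD//.
  rewrite normrM (gtr0_norm m0) -[leRHS]mulr1.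
  by apply: ler_wpM2l; [exact: ltW|exact: cutoff_cst_le1].
have bT : b <= T := le_trans bt tT.
have kapb x : x <= T -> fconv E kap x = n * primitive phi x + m * primitive kap x.
  move=> xT; rewrite -(kap_identity phii phic phiM xT) -(fconv_one kapi kapc xT).
  rewrite /fconv -RintegralZl//.
    rewrite -RintegralD//.
    + by apply: eq_Rintegral => y _; rewrite /E mulrDl mulrA.
    + exact: (integ_fconv_integrand x mD DM kapi).
    + by apply: integZ; exact: (integ_fconv_integrand x mone (@cutoff_cst_le1 _ T) kapi).
  exact: (integ_fconv_integrand x mone (@cutoff_cst_le1 _ T) kapi).
(* From [b - de] to [b] the primitive of [phi] does not decrease, and that of [kap] gains at least
   [n * de] because [kap >= n] there. *)
have lower : fconv E kap (b - de) + m * n * de <= fconv E kap b.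
  have bd : b - de <= b by rewrite gerBl ltW.
  rewrite !kapb//; last exact: le_trans bd bT.
  have p1 : primitive phi (b - de) <= primitive phi b.
    by rewrite -subr_ge0 primitiveB//; apply: Rintegral_ge0.
  have p2 : n * de <= primitive kap b - primitive kap (b - de).
    rewrite primitiveB// -[de in leLHS](_ : b - (b - de) = de); last by rewrite subKr.
    rewrite -Rintegral_itv_oc_cst//; apply: le_Rintegral => //.
    + exact: integrable_itv_oc_cst.
    + exact: integrable_subset.
    + by move=> x; rewrite /= in_itv /= => /andP[? ?]; apply: kap_ge; lra.
  have p3 : n * primitive phi (b - de) <= n * primitive phi b by rewrite ler_pM2l.
  have p4 : m * (n * de) <= m * (primitive kap b - primitive kap (b - de)).
    by rewrite ler_pM2l.
  by move: p3 p4; rewrite mulrBr -mulrA; lra.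
have kap0 x : x <= T -> 0 <= kap x.
  move=> xT; have [x0|x0] := leP x 0; first by rewrite kapc.
  by apply: (le_trans (ltW n0)); exact: kap_ge.
have Eone x : 0 < x -> x <= T -> E x = D x - D b.
  by move=> x0 xT; rewrite /E cutoff_in// mulr1.
(* [E] vanishes at [b], so the Lipschitz bound on [D] gives [E (b - x) <= C * de] for
   [0 < x <= de]. *)
have upper : fconv E kap b <= fconv E kap (b - de) + C * de * primitive kap de.
  apply: (fconv_shift_le (T := T) Ei _ EM kapi kapc) => //.
  - by move=> x x0; rewrite /E Dc// causal_cutoff// mulr0 addr0.
  - move=> x x0 xb; rewrite Eone//; last exact: le_trans xb bT.
    by rewrite subr_ge0; apply: Dmin; rewrite in_itv /= ltW// (le_trans xb).
  - move=> x x0 xd; have xb := le_lt_trans xd deb.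
    rewrite Eone ?subr_gt0//; last by apply: le_trans bT; rewrite gerBl ltW.
    apply: (le_trans (ler_norm _)); apply: (le_trans (Dlip _ _)).
    by rewrite addrAC subrr add0r normrN gtr0_norm// ler_wpM2l.
have pk0 : 0 <= primitive kap de.
  have := primitiveB kapi (ltW de0).
  rewrite (primitive_causal kapc (lexx 0)) subr0 => ->.
  apply: Rintegral_ge0 => x; rewrite /= in_itv /= => /andP[x0 xd].
  by apply: kap0; apply: le_trans xd _; apply: le_trans bT; exact: ltW.
have : m * n * de <= C * primitive kap de * de.
  by rewrite (mulrAC C) -(lerD2l (fconv E kap (b - de))); exact: le_trans upper.
rewrite ler_pM2r// leNgt => /negP; apply.
apply: (@le_lt_trans _ _ ((C + 1) * primitive kap de)).
  by rewrite ler_wpM2r// lerDl.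
by rewrite mulrC -ltr_pdivlMr//; exact: dP.
Unshelve. all: by end_near. Qed.

End Positivity.

(** * Lipschitz test functions approximating indicators of intervals *)

Section Ramp.
Context {R : realType}.
Notation mu := (@lebesgue_measure R).
Implicit Types x y c s : R.

Definition ramp x : R := Num.min 1 (Num.max 0 x).

Lemma ramp_ge0 x : 0 <= ramp x.
Proof. by rewrite le_min ler01 le_max lexx. Qed.

Lemma ramp_le1 x : ramp x <= 1.
Proof. by rewrite ge_min lexx. Qed.

Lemma ramp_le0 x : x <= 0 -> ramp x = 0.
Proof. by move=> x0; rewrite /ramp max_l// min_r. Qed.

Lemma ramp_ge1 x : 1 <= x -> ramp x = 1.
Proof. by move=> x1; rewrite /ramp max_r ?min_l//; lra. Qed.

Lemma rampE x : ramp x = if x <= 0 then 0 else if x <= 1 then x else 1.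
Proof.
have [/ramp_le0//|x0] := leP x 0; have [x1|/ltW/ramp_ge1//] := leP x 1.
by rewrite /ramp max_r ?min_r// ltW.
Qed.

Lemma ramp_nondecreasing x y : x <= y -> ramp x <= ramp y.
Proof.
move=> xy; rewrite !rampE; case: (leP x 0) => x0; case: (leP y 0) => y0 /=;
  case: (leP x 1) => x1; case: (leP y 1) => y1 /=; lra.
Qed.

Lemma ramp_lipschitz x y : `|ramp x - ramp y| <= `|x - y|.
Proof.
wlog xy : x y / x <= y.
  move=> h; case: (leP x y) => [/h//|/ltW/h]; by rewrite distrC (distrC y).
rewrite distrC (distrC x) ger0_norm ?subr_ge0 ?ramp_nondecreasing//.
rewrite ger0_norm ?subr_ge0//.
by rewrite !rampE; case: (leP x 0) => x0; case: (leP y 0) => y0 /=;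
  case: (leP x 1) => x1; case: (leP y 1) => y1 /=; lra.
Qed.

(** For [s >= 0] this converges pointwise to the indicator of []0, s]] as the slope [c] tends to
    infinity. *)
Definition trapezoid c s x : R := ramp (c * x) - ramp (c * (x - s)).

Lemma trapezoid_ge0 c s x : 0 <= c -> 0 <= s -> 0 <= trapezoid c s x.
Proof.
move=> c0 s0; rewrite subr_ge0; apply: ramp_nondecreasing.
by apply: ler_wpM2l => //; lra.
Qed.

Lemma trapezoid_le1 c s x : 0 <= c -> 0 <= s -> `|trapezoid c s x| <= 1.
Proof.
move=> c0 s0; rewrite ger0_norm ?trapezoid_ge0// /trapezoid.
by have := ramp_le1 (c * x); have := ramp_ge0 (c * (x - s)); lra.
Qed.

Lemma causal_trapezoid c s : 0 <= c -> 0 <= s -> causal (trapezoid c s).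
Proof.
move=> c0 s0 x x0; rewrite /trapezoid !ramp_le0 ?subrr//;
  apply: mulr_ge0_le0 => //; lra.
Qed.

Lemma trapezoid_lipschitz c s x y : 0 <= c ->
  `|trapezoid c s x - trapezoid c s y| <= 2 * c * `|x - y|.
Proof.
move=> c0; rewrite (_ : _ - _ = (ramp (c * x) - ramp (c * y)) +
  (ramp (c * (y - s)) - ramp (c * (x - s)))); last by rewrite /trapezoid; ring.
apply: (le_trans (ler_normD _ _)).
have h1 := ramp_lipschitz (c * x) (c * y).
have h2 := ramp_lipschitz (c * (y - s)) (c * (x - s)).
move: h1 h2; rewrite -!mulrBr !normrM (ger0_norm c0).
rewrite (_ : y - s - (x - s) = - (x - y)); last by ring.
by rewrite normrN -mulrA mulr_natl mulr2n; exact: lerD.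
Qed.

Lemma measurable_ramp : measurable_fun setT ramp.
Proof. by apply: measurable_minr => //; exact: measurable_maxr. Qed.

Lemma measurable_trapezoid c s : measurable_fun setT (trapezoid c s).
Proof.
apply: measurable_funB; apply: (measurableT_comp measurable_ramp).
  exact: measurable_funM.
by apply: measurable_funM => //; exact: measurable_funB.
Qed.

(** With slope at least 1 both ramps have reached 1 beyond [s + 1], so the support is bounded. *)
Lemma integ_trapezoid c s : 1 <= c -> 0 <= s -> integ (trapezoid c s).
Proof.
move=> c1 s0; have c0 : 0 <= c by lra.
apply: (le_integrable _ _ _ (integ_cutoff_cst (s + 1) 1)) => //.
  by apply/measurable_EFinP; exact: measurable_trapezoid.
move=> x _; rewrite /= lee_fin cutoffE.
case: ifPn => [_|]; first by rewrite normr1; exact: trapezoid_le1.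
rewrite negb_and -leNgt -ltNge => /orP[x0|xs].
  by rewrite causal_trapezoid// !normr0.
rewrite /trapezoid !ramp_ge1 ?subrr ?normr0//; nra.
Qed.

Lemma cvg_ramp x : ramp (j.+1%:R * x) @[j --> \oo] --> ((0 < x)%R%:R : R).
Proof.
apply: cvg_near_cst; have [x0|x0] := ltP 0 x.
  near=> j; apply: ramp_ge1; rewrite -ler_pdivrMr// div1r.
  rewrite (@le_trans _ _ j%:R) ?ler_nat//.
  by near: j; exact: nbhs_infty_ger.
by near=> j; apply: ramp_le0; rewrite mulr_ge0_le0.
Unshelve. all: by end_near. Qed.

(** Dominated convergence with majorant [|f|]. *)
Lemma fconv_trapezoid_cvg f (s t : R) : integ f -> s <= t ->
  (fconv (trapezoid j.+1%:R (t - s)) f t)%:E @[j --> \oo] -->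
  (\int[mu]_(x in `]s, t]) f x)%:E.
Proof.
move=> fi st; have st0 : 0 <= t - s by rewrite subr_ge0.
have mf := integ_measurable fi.
have fti (j : nat) : integ (fun x => trapezoid j.+1%:R (t - s) (t - x) * f x).
  apply: (integ_fconv_integrand (M := 1)) fi; first exact: measurable_trapezoid.
  by move=> x; exact: trapezoid_le1.
(* As a function of [x], the limit of the trapezoid at [t - x] is the indicator of [[s, t[];
   exchanging endpoints does not change the integral. *)
have -> : (\int[mu]_(x in `]s, t]) f x)%:E =
    (\int[mu]_x ((f \_ `[s, t[) x)%:E)%E.
  have fst : mu.-integrable `]s, t] (EFin \o f) by exact: integrable_subset.
  rewrite /Rintegral fineK; last exact: integrable_fin_num.
  rewrite -integral_itv_bndo_bndc; last exact/measurable_funTS/measurable_EFinP.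
  rewrite integral_itv_obnd_cbnd; last exact/measurable_funTS/measurable_EFinP.
  by rewrite integral_mkcond restrict_EFin.
rewrite [X in X @ \oo --> _](_ : _ = fun j => (\int[mu]_x
    (trapezoid j.+1%:R (t - s) (t - x) * f x)%:E)%E); last first.
  apply/funext => j; rewrite /fconv /Rintegral fineK//.
  exact: (integrable_fin_num measurableT (fti j)).
have mfst : measurable_fun setT (EFin \o (f \_ `[s, t[)).
  rewrite -restrict_EFin; apply: (measurable_int mu).
  by apply: (integrable_mkcond _ _).1 => //; exact: integrable_subset.
have [//|||||//] := @dominated_convergence _ _ _ mu setT measurableT
  (fun j x => (trapezoid j.+1%:R (t - s) (t - x) * f x)%:E)
  (EFin \o (f \_ `[s, t[)) (EFin \o (fun x => `|f x|)).
- by move=> j; exact: (measurable_int mu (fti j)).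
- exact: mfst.
- apply: aeW => x _; apply/cvg_EFin; first exact: nearW.
  have -> : (f \_ `[s, t[) x = ((0 < t - x)%R%:R - (0 < t - x - (t - s))%R%:R) * f x.
    rewrite patchE mem_setE in_itv /= subr_gt0.
    have -> : (0 < t - x - (t - s)) = (x < s) by apply/idP/idP; lra.
    have [sx|xs] := leP s x; first by case: (ltP x t) => _; rewrite subr0 ?mul1r ?mul0r.
    by rewrite (lt_le_trans xs st) subrr mul0r.
  by apply: cvgMr_tmp; apply: cvgB; exact: cvg_ramp.
- exact: (integrable_norm fi).
- apply: aeW => x j _ /=; rewrite lee_fin normrM -[leRHS]mul1r ler_wpM2r//.
  exact: trapezoid_le1.
Qed.

End Ramp.

(** * Comparison *)

Section Comparison.
Context {R : realType}.
Notation mu := (@lebesgue_measure R).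
Implicit Types (f g phi : R -> R) (t x : R).

Context (T n : R) (K L H : R -> R).
Hypotheses (Ki : integ K) (Li : integ L) (Hi : integ H).
Hypotheses (Kc : causal K) (Lc : causal L) (Hc : causal H).
Notation one := (cutoff T (cst 1)).
Hypothesis KL : {ae mu, forall x, x < T -> fconv K L x = one x}.
Hypothesis HL : {ae mu, forall x, x < T -> H x + n * fconv H L x = n * L x}.
Hypotheses (n0 : 0 < n).
Hypothesis K0 : forall x, 0 <= K x.

(** Increments of [primitive H] are limits of convolutions of [H] with trapezoids, hence
    nonnegative; differentiating the nondecreasing primitive gives the sign of [H]. *)
Lemma resolvent_ge0 :
  (forall x y, 0 < x -> x <= y -> y <= T -> K y <= K x) ->
  {ae mu, forall x, x < T -> 0 <= H x}.
Proof.
move=> Knincr; apply: nondecreasing_primitive_ge0 => // s t st tT.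
have st0 : 0 <= t - s by rewrite subr_ge0.
rewrite -subr_ge0 primitiveB// -lee_fin.
apply: cvge_ge (fconv_trapezoid_cvg Hi st); apply: nearW => j; rewrite lee_fin.
have j1 : 1 <= j.+1%:R :> R by rewrite ler1n.
have j0 : 0 <= j.+1%:R :> R := le_trans ler01 j1.
apply: (fconv_resolvent_ge0 Ki Li Hi Kc Hc KL HL n0 K0 Knincr
  (c := 2 * j.+1%:R) (M := 1)); last exact: ltW.
- exact: integ_trapezoid.
- exact: causal_trapezoid.
- by move=> x; exact: trapezoid_le1.
- by move=> x y; exact: trapezoid_lipschitz.
- by move=> x; exact: trapezoid_ge0.
Qed.

(** The resolvent identity for [phi = one] is this identity integrated once: it says that the
    difference [Q] of the two sides has zero primitive below [T]. *)
Lemma fconv_resolventE :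
  {ae mu, forall x, x < T -> fconv K H x = n * (one x - fconv one H x)}.
Proof.
have onei := integ_cutoff_cst T 1.
have onec : causal one := @causal_cutoff R T (cst 1).
have oneM := @cutoff_cst_le1 R T.
have mone := integ_measurable onei.
have mK := integ_measurable Ki; have mH := integ_measurable Hi.
have KHi := integ_fconv Ki Hi; have oHi := integ_fconv onei Hi.
pose g x := fconv one H x - one x.
have gi : integ g.
  by have := integrableB measurableT oHi onei; apply: eq_integrable => // x _ /=.
have gc : causal g by move=> x x0; rewrite /g (causal_fconv onec Hc)// onec// subr0.
pose Q x := fconv K H x + n * g x.
have Qi : integ Q by apply: integD => //; exact: integZ.
have Qc : causal Q.
  by move=> x x0; rewrite /Q (causal_fconv Kc Hc)// gc// mulr0 addr0.
have : {ae mu, forall x, x < T -> Q x = 0}.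
  apply: primitive_eq0 => // t tT; rewrite -(fconv_one Qi Qc (ltW tT)).
  have i1 f : integ f -> integ (fun x => one (t - x) * f x).
    exact: integ_fconv_integrand.
  rewrite /Q fconvDr ?fconvZr; [|exact: i1..|]; last exact/i1/integZ.
  have -> : fconv one g t = fconv one (fconv one H) t - fconv one one t.
    rewrite /g [LHS](_ : _ = fconv one (fun x => fconv one H x + -1 * one x) t).
      by rewrite fconvDr ?fconvZr ?mulN1r; [|exact: i1..|]; last exact/i1/integZ.
    by apply: eq_Rintegral => x _; rewrite mulN1r.
  have := resolvent_identity Ki Li Hi Kc Hc KL HL onei onec oneM (ltW tT).
  have -> : fconv K (fconv one H) = fconv one (fconv K H).
    rewrite (fconvC mK (integ_measurable oHi)) -(fconvA onei oneM Hi Ki).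
    by rewrite (fconvC mH mK).
  by move=> E; rewrite mulrBr addrA E subrr.
by apply: ae_imply => x Q0 /Q0; rewrite /Q /g; lra.
Qed.

(** The argument runs on [Z = one * y] because [Z] is bounded, so that it may serve as [phi] in the
    resolvent identity and in associativity; [y] is only integrable. *)
Lemma subsolution_eq0 y : integ y -> causal y -> (forall x, 0 <= y x) ->
  (forall x, 0 <= H x) -> {ae mu, forall x, x < T -> y x <= fconv H y x} ->
  {ae mu, forall x, x < T -> y x = 0}.
Proof.
move=> yi yc y0 H0 yH.
have onei := integ_cutoff_cst T 1.
have onec : causal one := @causal_cutoff R T (cst 1).
have one0 x : 0 <= one x by rewrite cutoffE; case: ifP.
have oneM := @cutoff_cst_le1 R T.
have mone := integ_measurable onei; have my := integ_measurable yi.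
have mK := integ_measurable Ki; have mH := integ_measurable Hi.
pose Z := fconv one y; pose B := fconv Z H.
have Zi : integ Z by exact: integ_fconv.
have Zc : causal Z by exact: causal_fconv.
have Z0 x : 0 <= Z x by apply: Rintegral_ge0 => z _; exact: mulr_ge0.
have mZ := integ_measurable Zi.
have ZM := fconv_bounded mone oneM yi.
have Bi : integ B by exact: integ_fconv.
have Bc : causal B by exact: causal_fconv.
have mB := integ_measurable Bi.
have BM := fconv_bounded mZ ZM Hi.
have Hyi : integ (fconv H y) by exact: integ_fconv.
have ZB t : t <= T -> Z t <= B t.
  rewrite /B /Z -(fconvA onei oneM yi Hi) (fconvC my mH).
  exact: (le_fconv_ae mone onec one0 oneM yi Hyi yH).
(* The identity for [phi = Z] reads [K * B + n (one * B) = n (one * Z)], and [Z <= B]. *)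
have KB0 t : t <= T -> fconv B K t <= 0.
  move=> tT; rewrite (fconvC mB mK).
  have E := resolvent_identity Ki Li Hi Kc Hc KL HL Zi Zc ZM tT.
  rewrite -(lerD2r (n * fconv one B t)) add0r E ler_pM2l//.
  apply: (le_fconv_ae mone onec one0 oneM Zi Bi _ tT).
  by apply: aeW => x /ltW; exact: ZB.
have KZ t : t <= T -> fconv Z K t = 0.
  move=> tT; apply/eqP; rewrite eq_le; apply/andP; split; last first.
    by apply: Rintegral_ge0 => x _; exact: mulr_ge0.
  apply: le_trans (KB0 _ tT); apply: le_Rintegral => //.
  - exact: (integ_fconv_integrand t mZ ZM Ki).
  - exact: (integ_fconv_integrand t mB BM Ki).
  - move=> x _; have [x0|x0] := leP x 0; first by rewrite Kc// !mulr0.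
    by apply: ler_wpM2r => //; apply: ZB; lra.
(* [one * Z] is [Z * (K * L)], which regroups as [(Z * K) * L = 0]. *)
have pZ t : t <= T -> primitive Z t = 0.
  move=> tT; rewrite -(fconv_one Zi Zc tT) (fconvC mone mZ).
  have <- : fconv Z (fconv K L) t = fconv Z one t.
    by apply: eq_fconv_ae tT => //; apply: integ_measurable; exact: integ_fconv.
  rewrite (fconvA Zi ZM Ki Li) /fconv.
  transitivity (\int[mu]_(x in setT) (0 : R)); last by rewrite Rintegral_cst// mul0r.
  apply: eq_Rintegral => x _.
  have [x0|x0] := leP x 0; first by rewrite Lc// mulr0.
  by rewrite -/(fconv Z K (t - x)) KZ ?mul0r//; lra.
apply: primitive_eq0 => // t tT.
have yZ s : s <= T -> Z s = primitive y s by exact: fconv_one.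
(* Since [y >= 0], [Z] is nondecreasing, so [Z t * (T - t)] is at most the integral of [Z] over []t,
   T]], which is 0; this gives [Z t = 0] at every [t < T]. *)
have Znd s : t <= s -> s <= T -> Z t <= Z s.
  move=> ts sT; rewrite !yZ//; last exact: ltW.
  by rewrite -subr_ge0 primitiveB//; exact: Rintegral_ge0.
rewrite -yZ ?ltW//; apply/eqP; rewrite eq_le Z0 andbT.
have Tt : 0 < T - t by rewrite subr_gt0.
have leT := ltW tT.
have : Z t * (T - t) <= primitive Z T - primitive Z t.
  rewrite primitiveB// -(Rintegral_itv_oc_cst (Z t) leT).
  apply: le_Rintegral => //.
  - exact: integrable_itv_oc_cst.
  - exact: integrable_subset.
  - move=> x; rewrite /= in_itv /= => /andP[tx xT].
    by apply: Znd => //; exact: ltW.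
by rewrite !pZ// subrr pmulr_lle0.
Qed.

End Comparison.

(** * Return to convolutions on [[0, T]] and the comparison principle *)

Section Main.
Context {R : realType}.
Notation leb := (@lebesgue_measure R).
Implicit Types (k l f g h u v : R -> R) (t x T : R).

Lemma cutoff_convol T f g x : L1 T f -> L1 T g -> x <= T ->
  cutoff T (convol f g) x = fconv (cutoff T f) (cutoff T g) x.
Proof.
move=> fi gi xT; have [x0|x0] := leP x 0.
  rewrite causal_cutoff// causal_fconv//; exact: causal_cutoff.
by rewrite cutoff_in// (convol_fconv fi gi xT).
Qed.

Lemma L1_convol T f g : L1 T f -> L1 T g -> L1 T (convol f g).
Proof.
move=> fi gi; have ci := integ_fconv (integ_cutoff fi) (integ_cutoff gi).
have := integrable_subset (A := `[0, T]) (measurable_itv _) ci.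
rewrite /L1; apply: eq_integrable => // x.
rewrite inE /= in_itv /= => /andP[_ xT].
by rewrite (convol_fconv fi gi xT).
Qed.

Lemma cutoff_kernels T k l : 0 < T -> PC k l ->
  {ae leb, forall x, x < T ->
    fconv (cutoff T k) (cutoff T l) x = cutoff T (cst 1) x}.
Proof.
move=> T0 [ki _ _ li kl]; apply: ae_imply kl => x kl xT.
have [x0|x0] := leP x 0.
  rewrite causal_cutoff// causal_fconv//; exact: causal_cutoff.
rewrite -(convol_fconv (ki T T0) (li T T0) (ltW xT)) kl//.
by rewrite cutoff_in// ltW.
Qed.

Lemma cutoff_resolvent T l h (n : nat) : 0 < T -> L1loc l -> is_h l n h ->
  {ae leb, forall x, x < T -> cutoff T h x +
    n%:R * fconv (cutoff T h) (cutoff T l) x = n%:R * cutoff T l x}.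
Proof.
move=> T0 li [hi hl]; apply: ae_imply hl => x hl xT.
have [x0|x0] := leP x 0.
  rewrite !causal_cutoff// causal_fconv//; try exact: causal_cutoff.
  by rewrite !mulr0 addr0.
rewrite -(convol_fconv (hi T T0) (li T T0) (ltW xT)).
by rewrite !(cutoff_in _ x0 (ltW xT)) hl.
Qed.

(** Inserting [K * H = n (one - one * H)] and reassociating turns [(K * H) * U] into [n (one * g)]
    with [g = U - H * U], that is, [n] times the primitive of [g]. *)
Lemma convol_resolvent_derive T k l h (n : nat) u : 0 < T -> (0 < n)%N ->
  PC k l -> is_h l n h -> L1 T u ->
  {ae leb, forall t, t < T -> derive1 (convol (convol k h) u) t =
    n%:R * (cutoff T u t - fconv (cutoff T h) (cutoff T u) t)}.
Proof.
move=> T0 n0 kl hh ui.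
have KL := cutoff_kernels T0 kl.
have HL := cutoff_resolvent T0 (PC_L1loc_l kl) hh.
have kT := PC_L1loc_k kl T0; have hT := hh.1 T T0.
have Ki := integ_cutoff kT; have Hi := integ_cutoff hT.
have Li := integ_cutoff (PC_L1loc_l kl T0).
have Ui := integ_cutoff ui.
pose K := cutoff T k; pose H := cutoff T h; pose U := cutoff T u.
pose one : R -> R := cutoff T (cst 1).
have onei : integ one := integ_cutoff_cst T 1.
have Hc : causal H := @causal_cutoff R T h.
have Uc : causal U := @causal_cutoff R T u.
have HUi : integ (fconv H U) by exact: integ_fconv.
have KH := fconv_resolventE Ki Li Hi (@causal_cutoff R T k) Hc KL HL.
pose g x := U x - fconv H U x.
have gi : integ g.
  by have := integrableB measurableT Ui HUi; apply: eq_integrable => // x _ /=.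
have gc : causal g by move=> x x0; rewrite /g Uc// causal_fconv// subr0.
have E t : t <= T -> convol (convol k h) u t = n%:R * primitive g t.
  move=> tT; rewrite (convol_fconv (L1_convol kT hT) ui tT).
  have mU := integ_measurable Ui.
  have ci := integ_cutoff (L1_convol kT hT).
  have oHi : integ (fconv one H) by exact: integ_fconv.
  pose q x := one x - fconv one H x.
  have qi : integ q.
    by have := integrableB measurableT onei oHi; apply: eq_integrable => // x _ /=.
  have nqi : integ (fun x => n%:R * q x) by exact: integZ.
  rewrite (fconvC (integ_measurable ci) mU).
  rewrite (@eq_fconv_ae _ T U _ (fun x => n%:R * q x))//; last 3 first.
  - exact: integ_measurable.
  - exact: integ_measurable.
  - by apply: ae_imply KH => x KH xT; rewrite (cutoff_convol kT hT (ltW xT)) KH.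
  rewrite (fconvC mU (integ_measurable nqi)) -(fconv_one gi gc tT).
  have oM := @cutoff_cst_le1 R T; have mone := integ_measurable onei.
  have oHM := fconv_bounded mone oM Hi.
  have moH := integ_measurable oHi.
  have i1 := integ_fconv_integrand t mone oM Ui.
  have i2 := integ_fconv_integrand t moH oHM Ui.
  transitivity (n%:R * (fconv one U t - fconv (fconv one H) U t)).
    rewrite /fconv -RintegralB// -RintegralZl//; last first.
      by have := integrableB measurableT i1 i2; apply: eq_integrable => // x _ /=.
    by apply: eq_Rintegral => x _; rewrite /q -mulrA mulrBl.
  congr (_ * _); rewrite -(fconvA onei oM Hi Ui).
  rewrite /fconv -RintegralB//; last exact: (integ_fconv_integrand t mone oM HUi).
  by apply: eq_Rintegral => x _; rewrite -mulrBr.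
(* [E] holds on a neighbourhood of each [t < T], so the derivatives agree wherever the primitive is
   differentiable. *)
apply: ae_imply (primitive_ae_derive gi) => t [dg dgE] tT.
rewrite -[X in _ * X]/(g t) -dgE derive1E.
rewrite (near_eq_derive (g := n%:R \*: primitive g)).
  by rewrite (deriveZ n%:R dg) derive1E.
by near=> s; apply: E; apply: ltW; near: s; exact: lt_nbhsl.
Unshelve. all: by end_near. Qed.

End Main.

Theorem lemma2p5 (R : realType) (k l : R -> R) (hPC : PC k l)
  (mu T : R) (hmu : 0 <= mu) (hT : 0 < T)
  (n : nat) (hn : (0 < n)%N)
  (h : R -> R) (hh : is_h l n h)
  (u v f : R -> R) (hu : L1 T u) (hv : L1 T v) (hf : L1 T f)
  (hsub : {ae lebesgue_measure, forall t : R, 0 < t < T ->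
     derive1 (convol (convol k h) u) t + mu * u t <= f t})
  (hsup : {ae lebesgue_measure, forall t : R, 0 < t < T ->
     f t <= derive1 (convol (convol k h) v) t + mu * v t}) :
  {ae lebesgue_measure, forall t : R, 0 < t < T -> u t <= v t}.
Proof.
have KL := cutoff_kernels hT hPC.
have HL := cutoff_resolvent hT (PC_L1loc_l hPC) hh.
have Ki := integ_cutoff (PC_L1loc_k hPC hT).
have Li := integ_cutoff (PC_L1loc_l hPC hT).
have Hi := integ_cutoff (hh.1 T hT).
have Ui := integ_cutoff hu; have Vi := integ_cutoff hv.
have n0 : 0 < n%:R :> R by rewrite ltr0n.
pose K := cutoff T k; pose L := cutoff T l; pose H := cutoff T h.
pose U := cutoff T u; pose V := cutoff T v.
have Kc : causal K := @causal_cutoff R T k.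
have Lc : causal L := @causal_cutoff R T l.
have Hc : causal H := @causal_cutoff R T h.
have K0 x : 0 <= K x.
  rewrite /K cutoffE; case: ifP => // /andP[x0 _]; exact: PC_ge0 hPC x x0.
have Knincr x y : 0 < x -> x <= y -> y <= T -> K y <= K x.
  move=> x0 xy yT; rewrite /K !cutoff_in//; first exact: PC_nonincreasing hPC _ _ x0 xy.
    exact: le_trans xy yT.
  exact: lt_le_trans x0 xy.
have H_ge0 := resolvent_ge0 Ki Li Hi Kc Hc KL HL n0 K0 Knincr.
(* The sign of [H] is known only almost everywhere below [T]; its positive part is nonnegative
   everywhere and gives the same convolutions up to [T]. *)
pose Hp x := Num.max 0 (H x).
have Hpi : integ Hp.
  have := integrable_funrpos measurableT Hi.
  by apply: eq_integrable => // x _ /=; rewrite /Hp maxC.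
have Hpc : causal Hp by move=> x x0; rewrite /Hp Hc// maxxx.
have Hp0 x : 0 <= Hp x by rewrite /Hp le_max lexx.
have HHp : {ae lebesgue_measure, forall x : R, x < T -> H x = Hp x}.
  by apply: ae_imply H_ge0 => x Hx /Hx H0; rewrite /Hp max_r.
have mH := integ_measurable Hi; have mHp := integ_measurable Hpi.
have fconvHp g t : integ g -> causal g -> t <= T -> fconv H g t = fconv Hp g t.
  move=> gi gc tT; have mg := integ_measurable gi.
  by rewrite (fconvC mH mg) (fconvC mHp mg); exact: (eq_fconv_ae gc mg mH mHp HHp).
have HpL : {ae lebesgue_measure, forall x : R, x < T ->
    Hp x + n%:R * fconv Hp L x = n%:R * L x}.
  apply: ae_imply2 HL HHp => x HL HHp xT.
  by rewrite -HHp// -fconvHp ?HL// ltW.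
pose y x := Num.max 0 (U x - V x).
have UVi : integ (fun x => U x - V x).
  by have := integrableB measurableT Ui Vi; apply: eq_integrable => // x _ /=.
have yi : integ y.
  have := integrable_funrpos measurableT UVi.
  by apply: eq_integrable => // x _ /=; rewrite /y maxC.
have yc : causal y.
  by move=> x x0; rewrite /y /U /V !causal_cutoff// subrr maxxx.
have y0 x : 0 <= y x by rewrite /y le_max lexx.
have yH : {ae lebesgue_measure, forall x : R, x < T -> y x <= fconv Hp y x}.
  have dU := convol_resolvent_derive hT hn hPC hh hu.
  have dV := convol_resolvent_derive hT hn hPC hh hv.
  have sU := ae_integ_section Hpi Ui; have sV := ae_integ_section Hpi Vi.
  have sy := ae_integ_section Hpi yi.
  (* Chaining the two differential inequalities through [f] and inserting the derivative formula. *)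
  have ineq : {ae lebesgue_measure, forall t : R, 0 < t < T ->
      (n%:R + mu) * (U t - V t) <= n%:R * (fconv Hp U t - fconv Hp V t)}.
    have h1 := ae_imply2 (fun t a b => conj a b) hsub hsup.
    have h2 := ae_imply2 (fun t a b => conj a b) dU dV.
    apply: ae_imply2 h1 h2 => t [a b] [c d] tT; move: (tT) => /andP[t0 tltT].
    have := le_trans (a tT) (b tT); rewrite c// d//.
    rewrite -[cutoff T h]/H -!fconvHp ?(ltW tltT)//; try exact: causal_cutoff.
    rewrite -/U -/V -[u t](cutoff_in u t0 (ltW tltT)) -[v t](cutoff_in v t0 (ltW tltT)).
    by rewrite -/U -/V; lra.
  (* Almost every [t] makes the three sections integrable, so that [U - V <= y] can be integrated
     against [Hp]. *)
  have sUV := ae_imply2 (fun t a b => conj a b) sU sV.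
  have s3 := ae_imply2 (fun t a b => conj a b) sUV sy.
  apply: ae_imply2 ineq s3 => t ineq [[iU iV] iy] tT.
  have [t0|t0] := leP t 0; first by rewrite yc// causal_fconv.
  have Hy0 : 0 <= fconv Hp y t by apply: Rintegral_ge0 => x _; exact: mulr_ge0.
  have le1 : fconv Hp U t - fconv Hp V t <= fconv Hp y t.
    rewrite /fconv -RintegralB//; apply: le_Rintegral => //.
      by have := integrableB measurableT iU iV; apply: eq_integrable => // x _ /=.
    by move=> x _; rewrite -mulrBr ler_wpM2l// /y le_max lexx orbT.
  have := ineq; rewrite t0 tT => /(_ isT) {}ineq.
  rewrite {1}/y ge_max Hy0 /= -(ler_pM2l n0).
  have [UV0|UV0] := leP (U t - V t) 0.
    by rewrite (@le_trans _ _ 0)// ?mulr_ge0_le0// ?mulr_ge0// ltW.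
  apply: (@le_trans _ _ ((n%:R + mu) * (U t - V t))).
    by rewrite ler_wpM2r// ?lerDl// ltW.
  by apply: (le_trans ineq); rewrite ler_pM2l.
have := subsolution_eq0 Ki Li Hpi Kc Lc Hpc KL HpL n0 K0 yi yc y0 Hp0 yH.
apply: ae_imply => t y0t /andP[t0 tT].
have := y0t tT; rewrite /y /U /V !cutoff_in ?(ltW tT)// => /eqP.
by rewrite eq_maxl subr_le0.
Qed.
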